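(* For any permutree $S$, the coproduct $\triangle\mathbb Q_S$ in the dual permutree algebra $\mathsf{PT}^*$ is given by $$\triangle\mathbb Q_S=\sum_\gamma\mathbb Q_{L(S,\gamma)}\otimes\mathbb Q_{R(S,\gamma)},$$ where $\gamma$ runs over all gaps between vertices of $S$.
   Context: Permutrees. A decoration of size $n$ is a word $\delta=\delta_1\cdots\delta_n$ in the symbols $\mathsf N$ (none), $\mathsf D$ (down), $\mathsf U$ (up), $\mathsf X$ (both). A permutree is a directed tree $T$ with $n$ vertices labeled bijectively by $[n]=\{1,\dots,n\}$ (vertices are identified with labels; $n=0$ allowed) in which each vertex has one or two parents (outgoing neighbors) and one or two children (incoming neighbors); a parent or child may be an unlabeled leaf (an up leaf, resp. down leaf). The ancestor (resp. descendant) subtree of $i$ through a given parent (resp. child) is the whole connected component, reached through it, of the tree with $i$ removed. If $i$ has two parents (resp. children), they are distinguished as left and right, and all labels in the left ancestor (resp. descendant) subtree of $i$ are smaller than $i$ while all labels in the right one are larger than $i$. The decoration of $T$ is given by $\delta(T)_i=\mathsf N,\mathsf D,\mathsf U,\mathsf X$ according to whether $i$ has (one parent, one child), (one parent, two children), (two parents, one child), (two parents, two children). Up labels are those decorated $\mathsf U$ or $\mathsf X$, down labels those decorated $\mathsf D$ or $\mathsf X$. Permutrees are drawn with edges oriented upwards and vertices from left to right by labels, so there is exactly one up (resp. down) leaf in each interval between consecutive up (resp. down) labels (including the two unbounded intervals). Gaps. The gaps of a permutree $S$ on $[n]$ are the $n+1$ positions between two consecutive integers of $[n]$, including the position before $1$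 and the position after $n$. A gap $\gamma$ defines the geodesic vertical path $\lambda(S,\gamma)$ in $S$ from the down leaf lying in the same interval between consecutive down labels as $\gamma$ to the up leaf lying in the same interval between consecutive up labels as $\gamma$. Splitting $S$ along $\lambda(S,\gamma)$ yields the left permutree $L(S,\gamma)$, containing the vertices with labels before $\gamma$, and the right permutree $R(S,\gamma)$, containing the vertices with labels after $\gamma$, with standardized labels (the path is doubled, its left copy running through the vertices of the path with labels before $\gamma$ and its right copy through the others; each vertex keeps its decoration). Dual algebra. A decorated permutation is a permutation of some $[n]$, $n\ge0$, each of whose letters carries a decoration. $\mathsf{FQSym}^*_{\{\mathsf N,\mathsf D,\mathsf U,\mathsf X\}}$ is the Hopf algebra (over a fixed field) with basis $(\mathbb G_\tau)$ indexed by decorated permutations, with product $\mathbb G_\tau\cdot\mathbb G_{\tau'}=\sum_\sigma\mathbb G_\sigma$ over all decorated permutations $\sigma$ whose first $n$ letters standardize to $\tau$ and last $n'$ letters standardize to $\tau'$ (decorations staying at their positions), and coproduct $\triangle\mathbb G_\sigma=\sum_{(\tau,\tau')}\mathbb G_\tau\otimes\mathbb G_{\tau'}$ over all pairs such that $\sigma$ is a shuffle of the word $\tau$ with the word $\tau'$ whose values are shifted by the length of $\tau$ (decorations travelling with values). $\mathsf{PT}^*$ is the quotient Hopf algebra identifying $\mathbb G_\tau$ and $\mathbb G_{\tau'}$ whenever $\tau,\tau'$ are linear extensions of the same permutree $T$, with each value $i$ decorated by $\delta(T)_i$ (a linear extension of $T$ is a permutation where $i$ appears before $j$ for each edge $i\to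 j$), and $\mathbb Q_T$ is the class of $\mathbb G_\tau$ for any linear extension $\tau$ of $T$ so decorated. *)

(* Defs.v *)
From HB Require Import structures.
From mathcomp Require Import all_boot all_order all_algebra perm.
From mathcomp Require Import finmap boolp.
From mathcomp.multinomials Require Import monalg.

Set Implicit Arguments.
Unset Strict Implicit.
Unset Printing Implicit Defensive.

Import GRing.Theory.

Local Open Scope quotient_scope.
Local Open Scope ring_scope.

Section Span.
Context {K : fieldType} {V : lmodType K}.

Definition span (G : V -> Prop) : {pred V} := fun x =>
  `[< exists s : seq (K * V),
        (forall p, p \in s -> G p.2) /\ x = \sum_(p <- s) p.1 *: p.2 >].

Context (G : V -> Prop).

Lemma span_gen x : G x -> x \in span G.
Proof.
move=> Gx; apply/asboolP; exists [:: (1, x)]; split.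
  by move=> p; rewrite inE => /eqP->.
by rewrite big_seq1 scale1r.
Qed.

Lemma span_submod : submod_closed (span G).
Proof.
split; first by apply/asboolP; exists [::]; rewrite big_nil.
move=> a u v /asboolP[s [sG ->]] /asboolP[t [tG ->]]; apply/asboolP.
exists ([seq (a * p.1, p.2) | p <- s] ++ t); split.
  move=> p; rewrite mem_cat => /orP[/mapP[q qs ->] /=|]; last exact: tG.
  exact: sG.
rewrite big_cat big_map scaler_sumr; congr (_ + _).
by apply: eq_bigr => p _; rewrite scalerA.
Qed.

HB.instance Definition _ :=
  GRing.isSubmodClosed.Build K V (span G) span_submod.

(* The quotient of V by the subspace spanned by G; [Quotient.quot] provides the
   additive structure, the scalar action is added below. *)
Definition lquot := Quotient.quot (span G : zmodClosed V).

HB.instance Definition _ := EqQuotient.on lquot.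
HB.instance Definition _ := GRing.Zmodule.on lquot.

Definition qpi (x : V) : lquot := \pi_lquot x.

Lemma qpiP x y : reflect (qpi x = qpi y) (x - y \in span G).
Proof. by rewrite Quotient.idealrBE; apply: eqP. Qed.

Lemma qpi_repr x : qpi (repr x) = x.
Proof. exact: reprK. Qed.

Lemma qpiD x y : qpi (x + y) = qpi x + qpi y.
Proof. exact: (raddfD \pi_(Quotient.quot (span G : zmodClosed V))). Qed.

Definition lquot_scale (a : K) (x : lquot) : lquot := qpi (a *: repr x).

Lemma qpiZ_def a x : qpi (a *: x) = lquot_scale a (qpi x).
Proof.
apply/qpiP; rewrite -scalerBr; apply: rpredZ; apply/qpiP.
by rewrite qpi_repr.
Qed.

Fact lquot_scaleA a b x :
  lquot_scale a (lquot_scale b x) = lquot_scale (a * b) x.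
Proof. by rewrite -[x]qpi_repr -!qpiZ_def scalerA. Qed.

Fact lquot_scale1 : left_id 1 lquot_scale.
Proof. by move=> x; rewrite -[x]qpi_repr -qpiZ_def scale1r. Qed.

Fact lquot_scaleDr : right_distributive lquot_scale +%R.
Proof.
move=> a x y; rewrite -[x]qpi_repr -[y]qpi_repr -qpiD -!qpiZ_def -qpiD.
by rewrite scalerDr.
Qed.

Fact lquot_scaleDl x : {morph lquot_scale^~ x : a b / a + b}.
Proof.
by move=> a b; rewrite -[x]qpi_repr -!qpiZ_def -qpiD scalerDl.
Qed.

HB.instance Definition _ := GRing.Zmodule_isLmodule.Build K lquot
  lquot_scaleA lquot_scale1 lquot_scaleDr lquot_scaleDl.

Fact qpi_is_linear : linear qpi.
Proof. by move=> a x y; rewrite qpiD qpiZ_def. Qed.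

HB.instance Definition _ :=
  GRing.isLinear.Build K V lquot _ qpi qpi_is_linear.

Lemma qpiZ a x : qpi (a *: x) = a *: qpi x.
Proof. exact: qpiZ_def. Qed.

(* The map induced on the quotient by f; [qliftE] shows that it is the induced
   map as soon as the linear map f vanishes on the generators G. *)
Definition qlift {U : lmodType K} (f : V -> U) (x : lquot) : U := f (repr x).

Lemma qliftE (U : lmodType K) (f : {linear V -> U}) :
  (forall x, G x -> f x = 0) -> forall x, qlift f (qpi x) = f x.
Proof.
move=> fG x; apply/eqP; rewrite -subr_eq0 -linearB.
have /qpiP/asboolP[s [sG ->]] : qpi (repr (qpi x)) = qpi x by rewrite qpi_repr.
rewrite linear_sum big_seq big1 // => p /sG/fG fp0.
by rewrite linearZ /= fp0 scaler0.
Qed.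

End Span.

Section Free.
Context {K : fieldType} {B : choiceType} {U : lmodType K}.

(* Linear extension of f : B -> U to the free space {malg K[B]} on B. *)
Definition linext (f : B -> U) (x : {malg K[B]}) : U :=
  \sum_(b <- msupp x) x@_b *: f b.

Lemma linextEw (f : B -> U) (x : {malg K[B]}) (d : {fset B}) :
  (msupp x `<=` d)%fset -> linext f x = \sum_(b <- d) x@_b *: f b.
Proof.
move=> le_xd; rewrite /linext (big_fset_incl _ le_xd) // => b _ /mcoeff_outdom->.
by rewrite scale0r.
Qed.

Fact linext_is_linear (f : B -> U) : linear (linext f).
Proof.
move=> a x y; pose d := (msupp x `|` msupp y `|` msupp (a *: x + y))%fset.
have dx : (msupp x `<=` d)%fset by rewrite /d -fsetUA fsubsetUl.
have dy : (msupp y `<=` d)%fset.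
  by rewrite /d (fsetUC (msupp x)) -fsetUA fsubsetUl.
have dxy : (msupp (a *: x + y) `<=` d)%fset by rewrite /d fsubsetUr.
rewrite (linextEw _ dx) (linextEw _ dy) (linextEw _ dxy) scaler_sumr -big_split.
by apply: eq_bigr => b _ /=; rewrite mcoeffD mcoeffZ scalerDl scalerA.
Qed.

HB.instance Definition _ (f : B -> U) :=
  GRing.isLinear.Build K {malg K[B]} U _ (linext f) (linext_is_linear f).

Lemma linextU (f : B -> U) b : linext f << b >> = f b.
Proof.
rewrite (@linextEw f _ [fset b]%fset) ?msuppU_le // big_seq_fset1.
by rewrite mcoeffU eqxx scale1r.
Qed.

End Free.

Section Tensor.
Context {K : fieldType}.

Inductive tensor_rel (V W : lmodType K) : {malg K[(V * W)%type]} -> Prop :=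
| TensorDl v v' w :
    tensor_rel (<< (v + v', w) >> - << (v, w) >> - << (v', w) >>)
| TensorDr v w w' :
    tensor_rel (<< (v, w + w') >> - << (v, w) >> - << (v, w') >>)
| TensorZl a v w : tensor_rel (<< (a *: v, w) >> - a *: << (v, w) >>)
| TensorZr a v w : tensor_rel (<< (v, a *: w) >> - a *: << (v, w) >>).

Arguments tensor_rel : clear implicits.

Definition tensor (V W : lmodType K) := lquot (tensor_rel V W).

HB.instance Definition _ (V W : lmodType K) := GRing.Lmodule.on (tensor V W).

Definition tens {V W : lmodType K} (v : V) (w : W) : tensor V W :=
  qpi (tensor_rel V W) << (v, w) >>.

Section TensorTheory.
Context {V W : lmodType K}.
Implicit Types (v : V) (w : W).

Lemma tensDl v v' w : tens (v + v') w = tens v w + tens v' w.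
Proof.
rewrite /tens -qpiD; apply/qpiP/span_gen; rewrite opprD addrA.
exact: TensorDl.
Qed.

Lemma tensDr v w w' : tens v (w + w') = tens v w + tens v w'.
Proof.
rewrite /tens -qpiD; apply/qpiP/span_gen; rewrite opprD addrA.
exact: TensorDr.
Qed.

Lemma tensZl a v w : tens (a *: v) w = a *: tens v w.
Proof.
rewrite /tens -qpiZ.
by apply/qpiP/span_gen; exact: TensorZl.
Qed.

Lemma tensZr a v w : tens v (a *: w) = a *: tens v w.
Proof.
rewrite /tens -qpiZ.
by apply/qpiP/span_gen; exact: TensorZr.
Qed.

End TensorTheory.

Context {V W V' W' : lmodType K}.

Definition tensor_map (f : V -> V') (g : W -> W') :
    tensor V W -> tensor V' W' :=
  qlift (linext (fun p : V * W => tens (f p.1) (g p.2))).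

Lemma tensor_mapE (f : {linear V -> V'}) (g : {linear W -> W'}) v w :
  tensor_map f g (tens v w) = tens (f v) (g w).
Proof.
rewrite /tensor_map {2}/tens qliftE /= ?linextU // => _ [].
- move=> x x' y; rewrite !linearB /= !linextU /= linearD tensDl.
  by rewrite -addrA -opprD subrr.
- move=> x y y'; rewrite !linearB /= !linextU /= linearD tensDr.
  by rewrite -addrA -opprD subrr.
- by move=> a x y; rewrite linearB linearZ /= !linextU /= linearZ tensZl subrr.
- by move=> a x y; rewrite linearB linearZ /= !linextU /= linearZ tensZr subrr.
Qed.

End Tensor.

Inductive decoration := DecN | DecD | DecU | DecX.

Definition is_up d := match d with DecU | DecX => true | _ => false end.
Definition is_down d := match d with DecD | DecX => true | _ => false end.

Definition decoration_of (b : bool * bool) :=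
  match b with
  | (false, false) => DecN
  | (false, true) => DecD
  | (true, false) => DecU
  | (true, true) => DecX
  end.

Lemma decoration_ofK : cancel (fun d => (is_up d, is_down d)) decoration_of.
Proof. by case. Qed.

HB.instance Definition _ := Finite.copy decoration (can_type decoration_ofK).

(* Vertices carry the labels 0, ..., n-1 instead of 1, ..., n. Only the edges
   between two vertices are recorded: [edge i j] is the upward edge from i to
   its parent j. The leaves are implicit, one for each parent or child that the
   decoration announces and that is not a vertex. *)
Record decograph (n : nat) := DecoGraph {
  deco : 'I_n -> decoration;
  edge : rel 'I_n
}.

Section Permutree.
Context {n : nat} (T : decograph n).

Definition up_label : pred 'I_n := fun i => is_up (deco T i).
Definition down_label : pred 'I_n := fun i => is_down (deco T i).

Definition parent : rel 'I_n := fun i j => edge T i j.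
Definition child : rel 'I_n := fun i j => edge T j i.
Definition adj : rel 'I_n := fun i j => edge T i j || edge T j i.

Definition is_directed_tree : Prop :=
  [/\ irreflexive (edge T),
      forall i j, edge T i j -> ~~ edge T j i,
      forall i j, connect adj i j
    & forall c : seq 'I_n, ucycle adj c -> (size c <= 2)%N].

(* k lies in the connected component of j once i is removed *)
Definition subtree (i j k : 'I_n) : bool :=
  connect (fun x y => [&& adj x y, x != i & y != i]) j k.

(* r is [parent] or [child], two tells whether i has two such neighbors or just
   one. A vertex in the left subtree of i is smaller than i, so a neighbor j of
   a vertex i with two sides is the left one if j < i and the right one if
   i < j; that side is occupied by a leaf if there is no such j. *)
Definition slots_ok (r : rel 'I_n) (two : bool) (i : 'I_n) : Prop :=
  if two then
    (forall j k, r i j -> subtree i j k -> (k < i)%N = (j < i)%N) /\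
    (forall j j', r i j -> r i j' -> (j < i)%N = (j' < i)%N -> j = j')
  else forall j j', r i j -> r i j' -> j = j'.

Definition is_permutree : Prop :=
  [/\ is_directed_tree,
      forall i, slots_ok parent (up_label i) i
    & forall i, slots_ok child (down_label i) i].

End Permutree.

Record permutree (n : nat) := Permutree {
  permutree_graph :> decograph n;
  permutreeP : is_permutree permutree_graph
}.

Section Split.
Context {n : nat} (T : decograph n).

(* The gap g : 'I_n.+1 lies just before the label g: the labels before it are
   the i < g and those after it the i >= g. Positions with the same value of
   [label_count P] are in the same interval between consecutive labels in P. *)
Definition label_count (P : pred 'I_n) (m : nat) : nat :=
  #|[pred i : 'I_n | P i & (i < m)%N]|.

(* v is attached to a leaf lying in the same interval between consecutive labels
   in P as the gap g, where (P, r) is (up_label, parent) for up leaves and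
   (down_label, child) for down leaves. If v is not in P, its unique possible
   leaf lies straight above (or below) v; otherwise its left and right leaves
   lie just before and just after v. *)
Definition leaf_at (P : pred 'I_n) (r : rel 'I_n) (g : nat) (v : 'I_n) : bool :=
  if P v then
    (label_count P g == label_count P v)
      && [forall j, r v j ==> ~~ (j < v)%N]
    || (label_count P g == label_count P v.+1)
      && [forall j, r v j ==> ~~ (v < j)%N]
  else
    (label_count P g == label_count P v) && [forall j, ~~ r v j].

(* The successive vertices of an upward path from the down leaf to the up leaf
   in the intervals of g. In a tree, an upward path is a geodesic. *)
Definition is_gap_path (g : nat) (p : seq 'I_n) : bool :=
  if p is a :: q then
    [&& leaf_at (down_label T) (child T) g a,
        path (edge T) a q
      & leaf_at (up_label T) (parent T) g (last a q)]
  else false.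

(* For n = 0, the path is a single edge from leaf to leaf, without vertices. *)
Definition gap_path (g : nat) : seq 'I_n :=
  if [pick p : n.-bseq 'I_n | is_gap_path g p] is Some p then p : seq 'I_n
  else [::].

(* One side of the splitting of T along the path of g, on the vertices in the
   image of the increasing map f. The edges of the path are replaced by those of
   the path running through its vertices on this side. *)
Definition split_side (m : nat) (f : 'I_m -> 'I_n) (g : nat) : decograph m :=
  let p := gap_path g in
  let q := [seq v <- p | v \in codom f] in
  {| deco i := deco T (f i);
     edge i j := (edge T (f i) (f j) && ~~ infix [:: f i; f j] p)
                 || infix [:: f i; f j] q |}.

Definition left_label (g : 'I_n.+1) (i : 'I_g) : 'I_n :=
  widen_ord (leq_ord g) i.
Definition right_label (g : 'I_n.+1) (i : 'I_(n - g)) : 'I_n :=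
  cast_ord (subnKC (leq_ord g)) (rshift g i).

Definition left_split (g : 'I_n.+1) : decograph g :=
  split_side (@left_label g) g.
Definition right_split (g : 'I_n.+1) : decograph (n - g) :=
  split_side (@right_label g) g.

End Split.

(* s.1 p is the letter at position p, with decoration s.2 p *)
Definition dperm (n : nat) : Type := ('S_n * {ffun 'I_n -> decoration})%type.
HB.instance Definition _ n := Finite.on (dperm n).

Definition word n (s : dperm n) : seq (nat * decoration) :=
  [seq (s.1 p : nat, s.2 p) | p <- enum 'I_n].

Definition shift_word (k : nat) (w : seq (nat * decoration)) :=
  [seq (k + l.1, l.2)%N | l <- w].

Definition is_shuffle (A : eqType) (w w1 w2 : seq A) : bool :=
  [exists m : (size w).-tuple bool,
     (mask m w == w1) && (mask (map negb m) w == w2)].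

Definition linear_extension n (T : decograph n) (s : dperm n) : bool :=
  [forall i, forall j, edge T i j ==> ((s.1^-1)%g i < (s.1^-1)%g j)%N]
  && [forall p, s.2 p == deco T (s.1 p)].

Section DualPermutreeAlgebra.
Context (K : fieldType).

Definition FQSymd := {malg K[{n & dperm n}]}.
HB.instance Definition _ := GRing.Lmodule.on FQSymd.

Definition Gbasis n (s : dperm n) : FQSymd := << Tagged dperm s >>.

(* A shuffle has the length of its two factors together, so that summing over
   the pairs of lengths (k, n - k) covers all pairs of decorated permutations. *)
Definition coprodG (b : {n & dperm n}) : tensor FQSymd FQSymd :=
  \sum_(k < (tag b).+1)
    \sum_(t : dperm k * dperm (tag b - k)
           | is_shuffle (word (tagged b)) (word t.1) (shift_word k (word t.2)))
       tens (Gbasis t.1) (Gbasis t.2).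

Definition coprodFQ : FQSymd -> tensor FQSymd FQSymd := linext coprodG.

Inductive permutree_rel : FQSymd -> Prop :=
  PermutreeRel n (T : permutree n) (s s' : dperm n) :
    linear_extension T s -> linear_extension T s' ->
    permutree_rel (Gbasis s - Gbasis s').

Definition PTd := lquot permutree_rel.
HB.instance Definition _ := GRing.Lmodule.on PTd.

Definition PTd_pi : FQSymd -> PTd := qpi permutree_rel.

(* The coproduct induced by coprodFQ on the quotient: it does not depend on the
   representative chosen by [qlift], the span of permutree_rel being a coideal. *)
Definition coprodPT : PTd -> tensor PTd PTd :=
  qlift (fun x => tensor_map PTd_pi PTd_pi (coprodFQ x)).

(* The value is meaningful when T is a permutree: linear extensions then exist
   and they all have the same class. *)
Definition Qbasis n (T : decograph n) : PTd :=
  if [pick s | linear_extension T s] is Some s then PTd_pi (Gbasis s) else 0.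

End DualPermutreeAlgebra.

(* Main.v *)
Require Import Defs.
From HB Require Import structures.
From mathcomp Require Import all_boot all_order all_algebra perm.
From mathcomp.multinomials Require Import monalg.
From mathcomp Require Import zify.

Set Implicit Arguments.
Unset Strict Implicit.
Unset Printing Implicit Defensive.

(** Let [s] be a linear extension of a permutree [T] on [n] labels. A value
    [k] cuts the word [s] into its letters below [k] and its other letters, and
    [s] is a shuffle of two standardized words in exactly these [n + 1] ways
    ([coprodG_restricts]). It is thus enough to see that the two words are
    linear extensions of the two sides of [T] split along the geodesic of the
    gap [k], and that these sides are permutrees: the coproduct of the class of
    [s] is then the announced sum ([coprod_linear_extension]), which depends on
    [T] only, so that the coproduct does descend to the quotient and the sum is
    its value on the class of [T].

    The combinatorics rests on one notion. A step from a vertex [v] to a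
    neighbor is away from the gap when [v] has a left and a right side in that
    direction and the step goes to the side opposite to the gap. All the
    labels reached by such a step lie on the same side of the gap as [v]
    ([away_any_monochrome]). Among the parents of a vertex at most one is not
    away, and likewise among its children.

    - Existence of the geodesic. Call a vertex central when it lies in none of
      the subtrees reached by steps away from the gap. Central vertices exist
      ([central_exists]), and a step from a central vertex that is not away
      leads to a central vertex. Climbing from a lowest central vertex along
      steps that are not away gives a directed path, and its ends are attached to
      the leaves of the gap ([leaf_at_of_away], which uses the turning points of
      geodesics described in [geodesic_turn]).

    - Conversely, along any path from the down leaf to the up leaf of the gap,
      the steps outside of the path are all away from the gap
      ([gap_path_exit]). Hence the edges outside of the path do not cross the
      gap ([off_path_monochrome]).

    - The sides of the splitting. Shortcutting the vertices of the other side on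
      the path preserves connectedness. An edge from [i] of a side starts in [T]
      with an edge from [i], leading into the same subtree ([split_first_step],
      [split_subtree]). Different edges start differently, so the absence of
      cycles and the conditions on left and right subtrees are inherited from
      [T] ([split_tree], [split_slots]). Finally, any function increasing along
      the edges of [T] increases along those of a side
      ([split_edge_increasing]), which gives the linear extensions. *)

(** * Directed trees *)

Lemma connect_ind (V : finType) (e : rel V) (Q : V -> Prop) (x y : V) :
    (forall z t, Q z -> e z t -> Q t) -> Q x -> connect e x y -> Q y.
Proof.
move=> step Qx /connectP[p]; elim: p x Qx => [x Qx _ -> //|z p IHp x Qx].
by case/andP=> xz pz; apply: IHp pz; apply: step xz.
Qed.

Section Tree.
Variables (n : nat) (T : decograph n).
Implicit Types (i j k x y : 'I_n).

Lemma adj_sym : symmetric (adj T).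
Proof. by move=> x y; rewrite /adj orbC. Qed.

Lemma edge_adj x y : edge T x y -> adj T x y.
Proof. by rewrite /adj => ->. Qed.

Lemma connect_adj_sym : connect_sym (adj T).
Proof. exact/sym_connect_sym/adj_sym. Qed.

Lemma subtree_sym i : symmetric (subtree T i).
Proof.
move=> j k; apply: sym_connect_sym => x y.
by rewrite adj_sym; congr (_ && _); rewrite andbC.
Qed.

Lemma subtree_refl i j : subtree T i j j.
Proof. exact: connect0. Qed.

Lemma subtree_trans i : transitive (subtree T i).
Proof. exact: connect_trans. Qed.

Lemma subtree1 i j k : adj T j k -> j != i -> k != i -> subtree T i j k.
Proof. by move=> jk ji ki; apply: connect1; rewrite jk ji ki. Qed.

Lemma subtree_neq i j k : subtree T i j k -> j != i -> k != i.
Proof.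
move=> jk ji; apply: (@connect_ind _ _ (fun k => k != i) _ _ _ ji jk).
by move=> x y _ /and3P[].
Qed.

Lemma path_subtree i j s :
  path (adj T) j s -> i \notin j :: s -> subtree T i j (last j s).
Proof.
elim: s j => [|k s IHs] j /=; first by rewrite subtree_refl.
case/andP=> jk ks; rewrite inE negb_or => /andP[ij iks].
apply: subtree_trans (IHs _ ks iks); apply: subtree1 => //; rewrite eq_sym //.
by move: iks; rewrite inE; case/norP.
Qed.

Lemma subtree_path i j k : subtree T i j k -> j != i ->
  exists s, [/\ path (adj T) j s, uniq (i :: j :: s) & last j s = k].
Proof.
move=> /connectP[p jp ->] ji; case/shortenP: jp => s js us _ {p}.
exists s; split => //.
  by apply: sub_path js => x y /and3P[].
rewrite cons_uniq us andbT inE negb_or eq_sym ji /=.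
by elim: s j js {us ji} => //= y s IHs x /andP[/and3P[_ _ yi] /IHs];
  rewrite inE negb_or eq_sym yi.
Qed.

(** This is equivalent to the absence of cycles, see [acyclicP], and passes more
    easily from a tree to the sides of its splittings. *)
Definition acyclic :=
  forall i j k, adj T i j -> adj T i k -> subtree T i j k -> j = k.

Lemma adj_irr : irreflexive (edge T) -> irreflexive (adj T).
Proof. by move=> irr x; rewrite /adj irr. Qed.

Lemma acyclicP : irreflexive (edge T) ->
  acyclic <-> (forall c : seq 'I_n, ucycle (adj T) c -> (size c <= 2)%N).
Proof.
move=> /adj_irr irr; split=> [acy [|i [|j s]] // | cyc i j k ij ik jk].
  rewrite /ucycle [cycle _ _]/= rcons_path cons_uniq.
  case/andP=> /and3P[ij js li] /andP[ijs /andP[jn _]].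
  have := acy i j (last j s) ij; rewrite adj_sym => /(_ li).
  move=> /(_ (path_subtree js ijs)) jE; case: s jn jE {js li ijs} => //= x s.
  by move=> /[swap] {1}->; rewrite mem_last.
have ji : j != i by apply: contraTneq ij => ->; rewrite irr.
have [s [js us sk]] := subtree_path jk ji.
have /cyc : ucycle (adj T) (i :: j :: s).
  by rewrite /ucycle us andbT /= ij rcons_path js sk adj_sym.
by case: s sk {js us}.
Qed.

Hypothesis treeT : is_directed_tree T.

Lemma edge_irr : irreflexive (edge T).
Proof. by case: treeT. Qed.

Lemma edge_anti x y : edge T x y -> edge T y x -> False.
Proof. by case: treeT => _ anti _ _ /anti/negP. Qed.

Lemma adj_neq x y : adj T x y -> x != y.
Proof. by apply: contraTneq => ->; rewrite (adj_irr edge_irr). Qed.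

Lemma tree_acyclic : acyclic.
Proof. by apply/acyclicP; [exact: edge_irr|case: treeT]. Qed.

Lemma edge_acyclic x y : edge T x y -> ~~ connect (edge T) y x.
Proof.
move=> xy; apply/negP=> /connectP[p yp xE]; move: xy; rewrite {}xE.
case/shortenP: yp => s ys us _ {p} xy.
have := treeT; case=> _ _ _ /(_ (y :: s)).
have cyc : ucycle (adj T) (y :: s).
  rewrite /ucycle us andbT /= rcons_path (edge_adj xy) andbT.
  by apply: sub_path ys; apply: edge_adj.
move=> /(_ cyc); case: s ys xy {us cyc} => [|z [|//]] /=.
  by rewrite edge_irr.
by rewrite andbT => yz /edge_anti /(_ yz).
Qed.

Lemma first_step i k : k != i -> exists2 w, adj T i w & subtree T i w k.
Proof.
have [_ _ conn _] := treeT; move=> ki; have /connectP[p ip kE] := conn i k.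
move: kE ki; case/shortenP: ip => -[|w s] /= iws us _ {p} ->.
  by rewrite eqxx.
case/andP: iws => iw ws _; exists w => //; apply: path_subtree => //.
by case/andP: us.
Qed.

Definition height x := #|[pred y | connect (edge T) y x]|.

Lemma height_edge x y : edge T x y -> (height x < height y)%N.
Proof.
move=> xy; apply/proper_card/properP; split.
  apply/subsetP=> z; rewrite !inE => /connect_trans; apply; exact: connect1.
by exists y; rewrite !inE ?connect0 // edge_acyclic.
Qed.

Lemma height_sorted p : sorted (edge T) p -> sorted (relpre height ltn) p.
Proof. by case: p => // a p; apply: sub_path => x y /height_edge. Qed.

Lemma height_trans : transitive (relpre height ltn).
Proof. move=> x y z; exact: ltn_trans. Qed.

Lemma edge_path_uniq p : sorted (edge T) p -> uniq p.
Proof.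
move=> /height_sorted; apply: sorted_uniq height_trans _ _.
by move=> x; rewrite /= ltnn.
Qed.

(** Sort the labels by height. *)
Lemma linear_extension_exists : exists s : dperm n, linear_extension T s.
Proof.
pose r x y := (height x <= height y)%N.
have r_tot : total r by move=> x y; apply: leq_total.
have r_tr : transitive r by move=> x y z; apply: leq_trans.
pose l := sort r (enum 'I_n).
have sz_l : size l = n by rewrite size_sort size_enum_ord.
have mem_l x : x \in l by rewrite mem_sort mem_enum.
have pos_lt x : (index x l < n)%N by rewrite -[X in (_ < X)%N]sz_l index_mem.
pose pos x := Ordinal (pos_lt x).
have pos_inj : injective pos.
  by move=> x y [] /(congr1 (nth x l)); rewrite !nth_index.
pose s : 'S_n := ((perm pos_inj)^-1)%g.
exists (s, [ffun p => deco T (s p)]); apply/andP; split; last first.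
  by apply/forallP=> p /=; rewrite ffunE.
apply/'forall_forallP=> x y; apply/implyP=> xy; rewrite /= /s invgK !permE /=.
have := height_edge xy; apply: contraTT; rewrite -!leqNgt => ple.
have l_sorted := sort_sorted r_tot (enum 'I_n).
have := sorted_leq_index r_tr (fun _ => leqnn _) l_sorted.
by move=> /(_ y x (mem_l y) (mem_l x)); apply.
Qed.

(** Leaving [u] along an edge traversed against [r], a geodesic either keeps
   going against [r], or has a first turning point [m], whose two neighbors on
   the geodesic are both [r]-neighbors. *)
Lemma geodesic_turn (r : rel 'I_n) u w v :
    (forall x y, adj T x y = r x y || r y x) ->
    r w u -> subtree T u w v ->
  (exists m a b, [/\ r m a, r m b, a != b, subtree T m a u & subtree T m b v])
  \/ exists2 a, r v a & subtree T v a u.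
Proof.
move=> adjE wu uwv.
have wNu : w != u by apply: adj_neq; rewrite adjE wu.
have [s [ws us <-]] := subtree_path uwv wNu; move=> {uwv wNu}.
have : (exists m a b, [/\ m \in belast w s, [&& r m a, r m b & a != b],
      subtree T m a u & subtree T m b (last w s)])
    \/ exists2 a, r (last w s) a & subtree T (last w s) a u.
  elim: s u w wu ws us => [|z s IHs] u w wu ws us.
    by right; exists u => //; apply: subtree_refl.
  have [wz zs] := andP ws; have {us} [uN uN'] := andP us.
  have wzs : w \notin z :: s by case/andP: uN'.
  have /orP[wz'|zw] : r w z || r z w by rewrite -adjE.
    left; exists w, u, z; split; rewrite ?mem_head ?subtree_refl //.
      rewrite wu wz' /=; apply: contraNneq uN => ->; rewrite !inE eqxx orbT //.
    exact: path_subtree.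
  (* The vertex [u] hangs at [w], so it is seen from the path as [w] is. *)
  have back m a : m \in z :: s -> subtree T m a w -> subtree T m a u.
    move=> mzs /subtree_trans; apply; apply: subtree1.
    - by rewrite adjE wu.
    - by apply: contraNneq wzs => ->.
    - by apply: contraNneq uN => ->; rewrite inE mzs orbT.
  case: (IHs w z zw zs uN') => [[m [a [b [ms mab aw bv]]]]|[a va aw]].
    left; exists m, a, b; split; rewrite //= ?inE ?ms ?orbT //.
    by apply: back => //; apply: mem_belast.
  by right; exists a => //; apply: back (mem_last z s) aw.
move=> [[m [a [b [_ /and3P[ma mb ab] au bv]]]]|]; last by right.
by left; exists m, a, b.
Qed.

End Tree.

(** * Steps away from a gap *)

Section LabelCount.
Variables (n : nat) (P : pred 'I_n).

Lemma label_count_eqP (a b : nat) :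
  reflect (forall u : 'I_n, P u -> (u < a)%N = (u < b)%N)
          (label_count P a == label_count P b).
Proof.
apply: (iffP eqP) => [|ab]; last first.
  apply: eq_card => u; rewrite !inE.
  by case Pu: (P u) => //=; apply: ab.
wlog ab : a b / (a <= b)%N => [IH ceq u Pu|ceq u Pu].
  case/orP: (leq_total a b) => [ab|ba]; first exact: IH.
  by apply/esym; apply: (IH b a).
have sub : [pred i : 'I_n | P i & (i < a)%N] \subset
           [pred i : 'I_n | P i & (i < b)%N].
  apply/subsetP=> v; rewrite !inE => /andP[-> va]; exact: leq_trans va ab.
by have /(_ u) := elimT (subset_cardP ceq) sub; rewrite !inE Pu.
Qed.

End LabelCount.

(** The pairs (up labels, parents) and (down labels, children) play the same
    role: one proof covers both ends of the paths. *)
Definition direction n (T : decograph n) (P : pred 'I_n) (r : rel 'I_n) :=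
  (forall x y, adj T x y = r x y || r y x) /\ (forall i, slots_ok T r (P i) i).

(** At a vertex [x] of [P], the gap [g] is on the right of [x] exactly when
    [x < g]; the test says that [y] is then on the left, and conversely. *)
Definition away n (P : pred 'I_n) (r : rel 'I_n) (g : nat) (x y : 'I_n) :=
  [&& r x y, P x & (y < x)%N == (x < g)%N].

(** The tactic [lia] reads the second form only. *)
Lemma ord_neq n (i j : 'I_n) : i != j -> i != j :> nat.
Proof. by []. Qed.

Section Direction.
Variables (n : nat) (T : decograph n) (P : pred 'I_n) (r : rel 'I_n) (g : nat).
Hypotheses (treeT : is_directed_tree T) (dirT : direction T P r).
Implicit Types (i j k u v w x y : 'I_n).

Lemma direction_adj x y : r x y -> adj T x y.
Proof. by case: dirT => -> _ ->. Qed.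

Lemma direction_neq x y : r x y -> x != y.
Proof. by move/direction_adj/(adj_neq treeT). Qed.

Lemma slot_side x y k :
  P x -> r x y -> subtree T x y k -> (k < x)%N = (y < x)%N.
Proof. by case: dirT => _ /(_ x) + Px; rewrite Px => -[+ _]; apply. Qed.

Lemma slot_inj x y z :
  r x y -> r x z -> (P x -> (y < x)%N = (z < x)%N) -> y = z.
Proof.
case: dirT => _ /(_ x); rewrite /slots_ok; case: (P x) => [[_ inj]|inj] xy xz.
  by move/(_ isT); apply: inj.
by move=> _; apply: inj.
Qed.

Lemma away_side x y k :
  away P r g x y -> subtree T x y k -> (k < x)%N = (x < g)%N.
Proof. by case/and3P=> xy Px /eqP <-; apply: slot_side. Qed.

Lemma not_away_inj x y z :
  r x y -> r x z -> ~~ away P r g x y -> ~~ away P r g x z -> y = z.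
Proof.
rewrite /away => xy xz; rewrite xy xz /= => yg zg.
apply: (slot_inj xy xz) => Px.
by move: yg zg; rewrite Px /=; do 3!case: (_ < _)%N.
Qed.

(** Equal label counts mean that no label of [P] separates the leaf from the
    gap. If [v] is in [P], this forces the leaf to be the one of its two leaves
    that faces the gap. *)
Lemma leaf_atP v :
  leaf_at P r g v <->
  (forall u, P u -> u != v -> (v < u)%N != (u < g)%N)
  /\ (forall y, r v y -> away P r g v y).
Proof.
rewrite /leaf_at /away; case Pv: (P v); split.
- case/orP=> /andP[/label_count_eqP cnt /forallP leaf].
    have gv : (v < g)%N = false by rewrite cnt // ltnn.
    split=> [u Pu /ord_neq uv|y vy]; first by rewrite (cnt u Pu); lia.
    by have := leaf y; rewrite vy gv /= => /negbTE->.
  have gv : (v < g)%N by rewrite cnt.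
  split=> [u Pu /ord_neq uv|y vy]; first by rewrite (cnt u Pu); lia.
  by have := leaf y; rewrite vy gv /=; have := ord_neq (direction_neq vy); lia.
- move=> [sep leaf]; have [vg|gv] := ltnP v g; apply/orP; [right|left].
    apply/andP; split.
      apply/label_count_eqP => u Pu; have [->|uv] := eqVneq u v.
        by rewrite vg leqnn.
      by have := sep u Pu uv; have := ord_neq uv; lia.
    by apply/forallP=> y; apply/implyP=> /leaf/and3P[_ _]; lia.
  apply/andP; split.
    apply/label_count_eqP => u Pu; have [->|uv] := eqVneq u v; first by lia.
    by have := sep u Pu uv; have := ord_neq uv; lia.
  by apply/forallP=> y; apply/implyP=> /leaf/and3P[_ _]; lia.
- case/andP=> /label_count_eqP cnt /forallP leaf.
  split=> [u Pu /ord_neq uv|y vy].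
    by rewrite (cnt u Pu); lia.
  by have := leaf y; rewrite vy.
- move=> [sep leaf]; apply/andP; split.
    apply/label_count_eqP => u Pu; have [uv|uv] := eqVneq u v.
      by rewrite uv Pv in Pu.
    by have := sep u Pu uv; have := ord_neq uv; lia.
  by apply/forallP=> y; apply/negP => /leaf/and3P[].
Qed.

(** A label [u] of [P] between [v] and the gap would contradict the hypotheses:
    depending on the geodesic from [u] to [v], the vertex [v] lies in a subtree
    going away from the gap at [u] or at a turning point, or else [u] lies in
    such a subtree at [v], although it is between [v] and the gap. *)
Lemma leaf_at_of_away v :
    (forall u w, away P r g u w -> ~~ subtree T u w v) ->
    (forall y, r v y -> away P r g v y) ->
  leaf_at P r g v.
Proof.
move=> cen leaf; apply/leaf_atP; split=> // u Pu uv; apply/negP=> /eqP sep.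
have [adjE _] := dirT.
have [w uw wv] : exists2 w, adj T u w & subtree T u w v.
  by apply: first_step => //; rewrite eq_sym.
have /orP[{}uw|{}wu] : r u w || r w u by rewrite -adjE.
  have /cen/negP : away P r g u w; last by [].
  by rewrite /away uw Pu -(slot_side Pu uw wv) sep /=.
(* The geodesic from [u] to [v] starts against [r]. At a turning point [m], the
   label of [m] separates [u], hence the gap, from [v]. *)
have /ord_neq := uv; case: (geodesic_turn treeT adjE wu wv)
  => [[m [a [b [ma mb ab au bv]]]]|[a va au]] {}uv.
  have Pm : P m.
    by apply: contraNT ab => Pm; apply/eqP/(slot_inj ma mb) => /(negP Pm).
  have sidea := slot_side Pm ma au; have sideb := slot_side Pm mb bv.
  have sides : (a < m)%N != (b < m)%N.
    by apply: contraNneq ab => ab; apply/eqP/(slot_inj ma mb).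
  have bm := subtree_neq bv; rewrite eq_sym (direction_neq mb) in bm.
  have {}bm := bm isT; move: (ord_neq bm) => {}bm.
  have mu : m != u :> nat.
    have am := subtree_neq au; rewrite eq_sym (direction_neq ma) in am.
    by have {}am := ord_neq (am isT); rewrite eq_sym.
  have /cen/negP : away P r g m b; last by [].
  by rewrite /away mb Pm /=; lia.
have := away_side (leaf a va) au; lia.
Qed.

Variables (a : 'I_n) (q : seq 'I_n).
Hypotheses (rp : path r a q) (up : uniq (a :: q)).
Hypothesis lp : leaf_at P r g (last a q).

(** A step away from the gap would leave the label of [x] between the gap and
    the end of the path. *)
Lemma gap_path_not_away x y : infix [:: x; y] (a :: q) -> ~~ away P r g x y.
Proof.
case/infixP=> s1 [s2 pE]; apply/negP=> xy.
have [sep _] := (leaf_atP _).1 lp.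
have lE : last a q = last y s2.
  by rewrite -[LHS]/(last x (a :: q)) pE last_cat.
have [rxy Px _] := and3P xy.
have ys : path r y s2.
  have : sorted r (a :: q) by [].
  by rewrite pE => /cat_sorted2[_] /= /andP[].
have xN : x \notin y :: s2.
  by move: up; rewrite pE cat_uniq => /and3P[_ _] /andP[].
have ys2 : subtree T x y (last y s2).
  apply: path_subtree => //; apply: sub_path ys; exact: direction_adj.
have xl : x != last y s2 by apply: contraNneq xN => ->; apply: mem_last.
have := sep x Px; rewrite lE xl => /(_ isT).
by rewrite (away_side xy ys2) eqxx.
Qed.

Lemma gap_path_exit v y :
  v \in a :: q -> r v y -> infix [:: v; y] (a :: q) || away P r g v y.
Proof.
move=> vp vy.
have [s1 [s2]] : exists s1 s2, a :: q = s1 ++ v :: s2.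
  by case/splitPr: vp => s1 s2; exists s1, s2.
case: s2 => [|z s2] pE.
  have vl : v = last a q.
    by rewrite -[RHS]/(last v (a :: q)) pE last_cat.
  by have [_ leaf] := (leaf_atP _).1 lp; rewrite orbC vl leaf -?vl.
have vz : infix [:: v; z] (a :: q) by apply/infixP; exists s1, s2.
have rvz : r v z.
  have : sorted r (a :: q) by [].
  by rewrite pE => /cat_sorted2[_] /= /andP[].
apply/orP; case vyA: (away P r g v y); [by right|left].
by rewrite (not_away_inj vy rvz) ?vyA // gap_path_not_away.
Qed.

End Direction.

(** * The geodesic of a gap *)

Lemma infix2_mem (A : eqType) (x y : A) s :
  infix [:: x; y] s -> x \in s /\ y \in s.
Proof. by move/mem_infix=> sub; rewrite !sub ?mem_head ?inE ?eqxx ?orbT. Qed.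

Section GapPath.
Variables (n : nat) (T : decograph n) (g : nat).
Hypothesis permT : is_permutree T.
Implicit Types (i j k u v w x y : 'I_n).

Lemma permutree_tree : is_directed_tree T.
Proof. by case: permT. Qed.

Lemma direction_up : direction T (up_label T) (parent T).
Proof. by split=> //; case: permT. Qed.

Lemma direction_down : direction T (down_label T) (child T).
Proof. by split=> [x y|]; [rewrite /adj orbC|case: permT]. Qed.

Let treeT := permutree_tree.
Let dirU := direction_up.
Let dirD := direction_down.

Definition away_any x y :=
  away (up_label T) (parent T) g x y || away (down_label T) (child T) g x y.

Lemma away_any_adj x y : away_any x y -> adj T x y.
Proof.
by rewrite /away_any /adj => /orP[]/and3P[xy _ _]; apply/orP; [left|right].
Qed.

Lemma away_any_neq x y : away_any x y -> y != x.
Proof. by move/away_any_adj/(adj_neq treeT); rewrite eq_sym. Qed.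

Lemma away_any_side x y k :
  away_any x y -> subtree T x y k -> (k < x)%N = (x < g)%N.
Proof. by case/orP; [exact: (away_side dirU)|exact: (away_side dirD)]. Qed.

Lemma away_any_monochrome x y k :
  away_any x y -> subtree T x y k -> (k < g)%N = (x < g)%N.
Proof.
move=> xy yk; have := away_any_side xy yk.
by have := ord_neq (subtree_neq yk (away_any_neq xy)); lia.
Qed.

(** Leaving a vertex of the geodesic of the gap elsewhere than along it goes
    away from the gap, so this describes the vertices of the geodesic without
    referring to its ends. *)
Definition central x :=
  [forall u, forall w, away_any u w ==> ~~ subtree T u w x].

Lemma centralP x :
  reflect (forall u w, away_any u w -> ~~ subtree T u w x) (central x).
Proof.
apply: (iffP forallP) => [cen u w uw|cen u]; last first.
  by apply/forallP=> w; apply/implyP/cen.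
by have /forallP/(_ w)/implyP := cen u; apply.
Qed.

(** If some step goes away from the gap, take one from [u] leading to a largest
    possible subtree: [u] is central. Suppose indeed that [u] is in the subtree
    of another such step, from [u']. Then [u'] is not in the subtree of the
    first step, otherwise each of [u] and [u'] would be between the other one
    and the gap; so the second subtree strictly contains the first. *)
Lemma central_exists : (0 < n)%N -> exists x, central x.
Proof.
move=> n_gt0; pose aw (p : 'I_n * 'I_n) := away_any p.1 p.2.
case: (pickP aw) => [p0 awp0|none]; last first.
  exists (Ordinal n_gt0); apply/centralP=> u w uw.
  by have := none (u, w); rewrite /aw uw.
case: (arg_maxnP (fun p => #|subtree T p.1 p.2|) awp0) => -[u w].
rewrite /aw /= => uw max.
exists u; apply/centralP=> u' w' uw'; apply/negP=> w'u.
have uNu' := subtree_neq w'u (away_any_neq uw').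
have u'N : ~~ subtree T u w u'.
  apply/negP=> wu'; have := away_any_side uw wu'.
  by have := away_any_side uw' w'u; have := ord_neq uNu'; lia.
have := max (u', w') uw'; apply/negP; rewrite -ltnNge; apply: proper_card.
apply/properP; split; last first.
  exists u => //; apply/negP=> /subtree_neq.
  by rewrite away_any_neq // eqxx => /(_ isT).
apply/subsetP=> k wk; rewrite unfold_in in wk *.
have wNu' : w != u' by apply: contraNneq u'N => <-; apply: subtree_refl.
pose Q z := subtree T u w z /\ subtree T u' w' z.
suff [] : Q k by [].
apply: (@connect_ind _ _ Q _ _ _ _ wk) => [z t [wz w'z] /and3P[zt zu tu]|].
  have wt : subtree T u w t by apply: subtree_trans wz _; apply: subtree1.
  split=> //; apply: subtree_trans w'z _; apply: subtree1 => //.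
    by apply: contraNneq u'N => <-.
  by apply: contraNneq u'N => <-.
split; first exact: subtree_refl.
by apply: subtree_trans w'u _; apply: subtree1 => //; apply: away_any_adj.
Qed.

(** The only step into a subtree starts from its root, here in a direction that
    is not away. *)
Lemma central_step x y : central x -> adj T x y -> ~~ away_any x y -> central y.
Proof.
move=> /centralP cen xy xyN; apply/centralP=> u w uw; apply/negP=> wy.
have yu := subtree_neq wy (away_any_neq uw).
have [xu|xu] := eqVneq x u.
  subst u; move: xyN; rewrite -(tree_acyclic treeT _ xy wy) ?uw //.
  exact: away_any_adj.
have /negP := cen u w uw; apply; apply: subtree_trans wy _.
by apply: subtree1; rewrite // adj_sym.
Qed.

Lemma central_up x y :
  central x -> edge T x y -> ~~ away (up_label T) (parent T) g x y -> central y.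
Proof.
move=> cen xy xyN; apply: central_step cen (edge_adj xy) _.
rewrite /away_any (negbTE xyN); apply/negP=> /and3P[].
by move/(edge_anti treeT xy).
Qed.

Lemma central_down x y :
  central x -> edge T y x -> ~~ away (down_label T) (child T) g x y ->
  central y.
Proof.
move=> cen yx xyN; apply: central_step cen _ _.
  by rewrite adj_sym; apply: edge_adj.
rewrite /away_any (negbTE xyN) orbF; apply/negP=> /and3P[].
by move/(edge_anti treeT yx).
Qed.

Lemma central_ascent x : central x ->
  exists q, [/\ path (edge T) x q, central (last x q)
    & forall y, edge T (last x q) y ->
                away (up_label T) (parent T) g (last x q) y].
Proof.
have [m] := ubnP (n - height T x); elim: m x => // m IHm x xm cen.
have [/existsP[y /andP[xy xyN]]|/existsPn stop] :=
  boolP [exists y, edge T x y && ~~ away (up_label T) (parent T) g x y].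
  have hy : (height T y <= n)%N.
    by rewrite -[X in (_ <= X)%N]card_ord; apply: max_card.
  have [|q [yq cq top]] := IHm y _ (central_up cen xy xyN).
    by have := height_edge treeT xy; lia.
  by exists (y :: q); split; rewrite //= xy.
by exists [::]; split=> // y xy; have := stop y; rewrite xy /= negbK.
Qed.

(** Take a central vertex of least height, so that it has no central child, and
    climb. *)
Lemma gap_path_exists : (0 < n)%N -> exists p, is_gap_path T g p.
Proof.
move=> /central_exists[x0 cen0].
case: (arg_minnP (height T) cen0) => x cen low.
have [q [xq cq top]] := central_ascent cen.
exists (x :: q); apply/and3P; split=> //.
  apply: (leaf_at_of_away treeT dirD) => // [u w uw|y yx].
    by have /centralP := cen; apply; rewrite /away_any uw orbT.
  apply: contraT => xyN; have := low y (central_down cen yx xyN).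
  by rewrite leqNgt height_edge.
apply: (leaf_at_of_away treeT dirU) => // u w uw.
by have /centralP := cq; apply; rewrite /away_any uw.
Qed.

Lemma gap_path_sorted p : is_gap_path T g p -> sorted (edge T) p.
Proof. by case: p => //= a q /and3P[]. Qed.

Lemma gap_pathP : (0 < n)%N -> is_gap_path T g (gap_path T g).
Proof.
move=> /gap_path_exists[p pP]; rewrite /gap_path; case: pickP => //= none.
have size_p : (size p <= n)%N.
  have /card_uniqP <- := edge_path_uniq treeT (gap_path_sorted pP).
  by rewrite -[X in (_ <= X)%N]card_ord max_card.
by have := none (Bseq size_p); rewrite /= pP.
Qed.

Variable p : seq 'I_n.
Hypothesis gp : is_gap_path T g p.

Lemma gap_path_up_exit v y : v \in p -> edge T v y ->
  infix [:: v; y] p || away (up_label T) (parent T) g v y.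
Proof.
have := edge_path_uniq treeT (gap_path_sorted gp); move: gp.
by case: p => // a q /and3P[_ aq top] up; exact: (gap_path_exit treeT dirU).
Qed.

Lemma gap_path_down_exit v y : v \in p -> edge T y v ->
  infix [:: y; v] p || away (down_label T) (child T) g v y.
Proof.
have := edge_path_uniq treeT (gap_path_sorted gp); move: gp.
case: p => // a q /and3P[bot aq _] up vp yv.
have revE : rev (a :: q) = last a q :: rev (belast a q).
  by rewrite lastI rev_rcons.
rewrite -infix_rev revE.
apply: (gap_path_exit treeT dirD) => //.
- by rewrite rev_path.
- by rewrite -revE rev_uniq.
- suff -> : last (last a q) (rev (belast a q)) = a by [].
  by case: (q) => //= x s; rewrite rev_cons last_rcons.
- by rewrite -revE mem_rev.
Qed.

(** Removing the edges of the path leaves one component for each of its vertices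
    [v], made of [v] and of the subtrees going away from the gap at [v]:
    whatever leaves the path does so away from the gap. *)
Lemma gap_path_component x : (0 < n)%N ->
  x \in p \/ exists v w, [/\ v \in p, away_any v w & subtree T v w x].
Proof.
move=> n_gt0; have [a ap] : exists a, a \in p.
  by case: (p) gp => // a q _; exists a; apply: mem_head.
have [_ _ /(_ a x) conn _] := treeT.
pose Q x := x \in p \/ exists v w, [/\ v \in p, away_any v w & subtree T v w x].
apply: (@connect_ind _ _ Q _ _ _ _ conn) => {x conn}; last by left.
move=> x y [xp|[v [w [vp vw wx]]]] xy.
  have [/infix2_mem[]|xyI] := boolP (infix [:: x; y] p); first by left.
  have [/infix2_mem[]|yxI] := boolP (infix [:: y; x] p); first by left.
  right; exists x, y; split; rewrite ?subtree_refl //; case/orP: xy => xy.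
    by have := gap_path_up_exit xp xy; rewrite (negbTE xyI) /away_any /= => ->.
  have := gap_path_down_exit xp xy; rewrite (negbTE yxI) /away_any => /= ->.
  by rewrite orbT.
have [->|yv] := eqVneq y v; first by left.
right; exists v, w; split=> //.
apply: (subtree_trans wx); apply: subtree1 => //.
exact: subtree_neq wx (away_any_neq vw).
Qed.

Lemma off_path_monochrome x y :
  edge T x y -> ~~ infix [:: x; y] p -> (x < g)%N = (y < g)%N.
Proof.
move=> xy xyN; have n_gt0 : (0 < n)%N by apply: leq_ltn_trans (ltn_ord x).
case: (gap_path_component x n_gt0) => [xp|[v [w [vp vw wx]]]].
  have := gap_path_up_exit xp xy; rewrite (negbTE xyN) /= => xyA.
  by rewrite (@away_any_monochrome x y y) ?subtree_refl // /away_any xyA.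
have [yv|yv] := eqVneq y v.
  subst v; have := gap_path_down_exit vp xy; rewrite (negbTE xyN) /= => yxA.
  by rewrite (@away_any_monochrome y x x) ?subtree_refl // /away_any yxA orbT.
rewrite !(away_any_monochrome vw) //; apply: (subtree_trans wx).
apply: subtree1 => //; first exact: edge_adj.
exact: subtree_neq wx (away_any_neq vw).
Qed.

End GapPath.

(** * Splitting along the geodesic *)

Section Infix.
Variable A : eqType.
Implicit Types (a b c x y : A) (s t : seq A).

Lemma infix2_filter (P : pred A) a b s : infix [:: a; b] (filter P s) ->
  exists s1 s2 s3, s = s1 ++ a :: s2 ++ b :: s3 /\ all (predC P) s2.
Proof.
have head t : prefix [:: b] (filter P t) ->
    exists s2 s3, t = s2 ++ b :: s3 /\ all (predC P) s2.
  elim: t => //= x t IHt; case: ifP => [Px|Px bt].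
    by rewrite /= => /andP[/eqP-> _]; exists [::], t.
  by have [s2 [s3 [-> s2P]]] := IHt bt; exists (x :: s2), s3; rewrite /= Px.
have cons x t :
    (exists s1 s2 s3, t = s1 ++ a :: s2 ++ b :: s3 /\ all (predC P) s2) ->
    exists s1 s2 s3, x :: t = s1 ++ a :: s2 ++ b :: s3 /\ all (predC P) s2.
  by case=> s1 [s2 [s3 [-> s2P]]]; exists (x :: s1), s2, s3.
elim: s => //= x s IHs; case: ifP => [Px|_]; last by move/IHs/cons.
rewrite infix_consl => /orP[|/IHs/cons //].
rewrite prefix_cons => /andP[/eqP-> /head[s2 [s3 [-> s2P]]]].
by exists [::], s2, s3.
Qed.

Lemma infix2_path (e : rel A) a b s : sorted e s -> infix [:: a; b] s -> e a b.
Proof.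
move=> es /infixP[s1 [s2 sE]]; move: es.
by rewrite sE => /cat_sorted2[_] /andP[].
Qed.

Lemma infix2_inj a b c s :
  uniq s -> infix [:: a; b] s -> infix [:: a; c] s -> b = c.
Proof.
elim: s => [|x s IHs] //; rewrite !infix_consl !prefix_cons => /andP[xs us].
case: eqVneq => [<-|_] /= in xs *; last exact: IHs.
have inN d : infix [:: a; d] s = false.
  by apply: contraNF xs => /infix2_mem[].
by rewrite !inN !orbF; case: (s) => //= y t /andP[/eqP-> _] /andP[/eqP-> _].
Qed.

Lemma sorted_infix2 s : sorted (fun x y => infix [:: x; y] s) s.
Proof.
elim: s => // x [//|y s] IHs; rewrite [sorted _ _]/=; apply/andP; split.
  exact: (@prefix_infix _ [:: x; y] s).
apply: sub_path IHs => u v; exact: (@infix_catl _ _ _ [:: x]).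
Qed.

End Infix.

Lemma ord_mono_inj n m (f : 'I_m -> 'I_n) :
  (forall i j, (f i < f j)%N = (i < j)%N) -> injective f.
Proof.
move=> f_mono i j ij; apply/val_inj => /=.
by have := f_mono i j; have := f_mono j i; rewrite ij; lia.
Qed.

(** One statement covers both sides: [f] enumerates increasingly the labels
    before the gap if [side] holds, and those after it otherwise. *)
Section Split.
Variables (n : nat) (T : decograph n) (g : nat) (permT : is_permutree T).
Variables (m : nat) (f : 'I_m -> 'I_n) (side : bool).
Hypothesis f_mono : forall i j, (f i < f j)%N = (i < j)%N.
Hypothesis f_side : forall x, (x \in codom f) = ((x < g)%N == side).
Hypothesis n_gt0 : (0 < n)%N.
Implicit Types (i j k : 'I_m) (x y v : 'I_n).

Let treeT := permutree_tree permT.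
Let p := gap_path T g.
Let q := [seq v <- p | v \in codom f].
Let T' := split_side T f g.

Let gp : is_gap_path T g p.
Proof. exact: gap_pathP. Qed.

Let p_sorted : sorted (edge T) p := gap_path_sorted gp.
Let p_uniq : uniq p := edge_path_uniq treeT p_sorted.
Let q_uniq : uniq q.
Proof. exact: filter_uniq. Qed.

Let split_inj : injective f := ord_mono_inj f_mono.

Lemma split_edge_increasing (h : 'I_n -> nat) :
    (forall x y, edge T x y -> (h x < h y)%N) ->
  forall i j, edge T' i j -> (h (f i) < h (f j))%N.
Proof.
move=> h_edge i j /orP[/andP[/h_edge//]|].
apply: (@infix2_path _ (relpre h ltn)); apply: sorted_filter.
  by move=> x y z; apply: ltn_trans.
rewrite -/p; have := p_sorted; case: (p) => //= a s.
by apply: sub_path => x y /h_edge.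
Qed.

(** An edge that is new in the split replaces a segment of the path whose inner
    vertices are all on the other side, so this segment avoids [f i]. *)
Lemma split_adj_subtree i j k :
  adj T' j k -> j != i -> k != i -> subtree T (f i) (f j) (f k).
Proof.
wlog jk : j k / edge T' j k => [IH /orP[] jk ji ki|_].
- by apply: IH; rewrite ?edge_adj.
- by rewrite subtree_sym; apply: IH; rewrite ?edge_adj.
rewrite -!(inj_eq split_inj) => ji ki; case/orP: jk => [/andP[jk _]|].
  by apply: subtree1; rewrite ?edge_adj.
case/infix2_filter=> s1 [s2 [s3 [pE s2N]]].
rewrite -/p in pE.
have -> : f k = last (f j) (rcons s2 (f k)) by rewrite last_rcons.
apply: path_subtree.
  have := p_sorted; rewrite pE => /cat_sorted2[_]; rewrite /= -cat_rcons.
  by rewrite cat_path => /andP[+ _]; apply: sub_path; apply: edge_adj.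
rewrite inE mem_rcons inE !negb_or eq_sym ji eq_sym ki /=.
apply/negP=> /(allP s2N) /=; by rewrite codom_f.
Qed.

(** An edge of the split stands for a segment of [T]; [x] is the first vertex of
    this segment. The edge is recovered from [x]: it is the edge to [x] itself
    or, if [x] follows [f i] on the path, the step from [f i] on the restricted
    path. With [s] the path or its reversal, this serves for both parents and
    children. *)
Lemma split_first_step (r : rel 'I_n) (r' : rel 'I_m) s i j :
    subrel r (adj T) -> sorted r s -> uniq s ->
    r' i j = (r (f i) (f j) && ~~ infix [:: f i; f j] s)
             || infix [:: f i; f j] [seq v <- s | v \in codom f] ->
    r' i j ->
  exists x, [/\ r (f i) x, subtree T (f i) x (f j)
    & if infix [:: f i; x] s
      then is_true (infix [:: f i; f j] [seq v <- s | v \in codom f])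
      else f j = x].
Proof.
move=> r_adj s_sorted s_uniq -> /orP[/andP[ij ijN]|ij].
  by exists (f j); split; rewrite ?subtree_refl // (negbTE ijN).
have [s1 [s2 [s3 [sE s2N]]]] := infix2_filter ij.
have [x [s4 xE]] : exists x s4, s2 ++ f j :: s3 = x :: s4.
  by case: (s2) => [|x s4]; [exists (f j), s3|exists x, (s4 ++ f j :: s3)].
have xs : infix [:: f i; x] s by rewrite sE xE; apply/infixP; exists s1, s4.
exists x; rewrite xs; split=> //; first exact: infix2_path xs.
have [t xt] : exists t, rcons s2 (f j) = x :: t.
  by case: (s2) xE => [|y s5] [-> _]; [exists [::]|exists (rcons s5 (f j))].
have -> : f j = last x t by rewrite -[RHS]/(last x (x :: t)) -xt last_rcons.
move: s_sorted s_uniq; rewrite sE -(cat_rcons (f j)) xt.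
move=> /cat_sorted2[_] /= /andP[_].
rewrite cat_path cat_uniq => /andP[xtp _] /and3P[_ _] /andP[fiN _].
apply: path_subtree; first exact: sub_path xtp.
by apply: contra fiN => fi; rewrite -cat_cons mem_cat fi.
Qed.

Lemma split_subtree i j k x :
  subtree T (f i) x (f j) -> j != i -> subtree T' i j k ->
  subtree T (f i) x (f k).
Proof.
move=> xj ji.
apply: (@connect_ind _ _ (fun k => subtree T (f i) x (f k))) => //.
move=> {}j {}k {}xj /and3P[jk {}ji ki]; apply: subtree_trans xj _.
exact: split_adj_subtree.
Qed.

Let off x y := [&& adj T x y, ~~ infix [:: x; y] p & ~~ infix [:: y; x] p].

(** The edges off the path do not cross the gap, so that each vertex is linked
    to a vertex of the path on its own side by edges that the split keeps. *)
Lemma split_connected i j : connect (adj T') i j.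
Proof.
have off_side x y : off x y -> (x < g)%N = (y < g)%N.
  case/and3P=> /orP[] xy xyN yxN.
    exact: (off_path_monochrome permT gp xy xyN).
  exact: esym (off_path_monochrome permT gp xy yxN).
have reach x : exists v, [/\ v \in p, (v < g)%N = (x < g)%N & connect off v x].
  have [a ap] : exists a, a \in p.
    by case: (p) gp => // a s _; exists a; apply: mem_head.
  have [_ _ /(_ a x) conn _] := treeT.
  pose Q x := exists v, [/\ v \in p, (v < g)%N = (x < g)%N & connect off v x].
  apply: (@connect_ind _ _ Q _ _ _ _ conn) => {x conn}; last by exists a.
  move=> x y [v [vp vx conn]] xy.
  have [/infix2_mem[_ yp]|xyN] := boolP (infix [:: x; y] p); first by exists y.
  have [/infix2_mem[yp _]|yxN] := boolP (infix [:: y; x] p); first by exists y.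
  have xyO : off x y by rewrite /off xy xyN yxN.
  exists v; split=> //; first by rewrite vx (off_side _ _ xyO).
  exact: connect_trans conn (connect1 xyO).
have conn_q k : exists2 l, f l \in q & connect (adj T') l k.
  have [v [vp vk conn]] := reach (f k).
  have vC : v \in codom f by rewrite f_side vk -f_side codom_f.
  have [l vE] := codomP vC; exists l; first by rewrite -vE mem_filter vC.
  pose Q x := exists2 l', f l' = x & connect (adj T') l l'.
  suff [k' /split_inj->] : Q (f k) by [].
  apply: (@connect_ind _ _ Q _ _ _ _ conn); last by exists l.
  move=> x y [k' <- lk'] xy.
  have /codomP[l' yE] : y \in codom f.
    by rewrite f_side -(off_side _ _ xy) -f_side codom_f.
  exists l' => //; apply: connect_trans lk' (connect1 _); move: xy.
  by rewrite yE /off /adj /= => /and3P[/orP[]-> -> ->] /=; rewrite ?orbT.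
have [q' qE] : exists q', q = map f q'.
  have : {subset q <= codom f} by move=> v; rewrite mem_filter => /andP[].
  elim: (q) => [|v s IHs] sub; first by exists [::].
  have /codomP[l ->] := sub v (mem_head v s).
  have [|s' ->] := IHs; first by move=> u us; apply: sub; rewrite inE us orbT.
  by exists (l :: s').
have q'_sorted : sorted (adj T') q'.
  have := sorted_infix2 q; rewrite {2}qE sorted_map.
  apply: sub_sorted => k l kl.
  by apply/orP; left; apply/orP; right.
have [k kq ki] := conn_q i; have [l lq lj] := conn_q j.
rewrite qE !mem_map ?(mem_map split_inj) in kq lq; try exact: split_inj.
apply: connect_trans lj; apply: (@connect_trans _ _ k).
  by rewrite connect_adj_sym.
move: q'_sorted kq lq; case: (q') => //= a s /path_connect conn kq lq.
by apply: (@connect_trans _ _ a); [rewrite connect_adj_sym|]; apply: conn.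
Qed.

Let lands_up i j x : Prop :=
  if infix [:: f i; x] p then is_true (infix [:: f i; f j] q) else f j = x.
Let lands_down i j x : Prop :=
  if infix [:: x; f i] p then is_true (infix [:: f j; f i] q) else f j = x.

Lemma split_first_up i j : edge T' i j -> exists x,
  [/\ edge T (f i) x, subtree T (f i) x (f j) & lands_up i j x].
Proof.
by apply: (@split_first_step (edge T) (edge T')) => //; apply: edge_adj.
Qed.

Lemma split_first_down i j : edge T' j i -> exists x,
  [/\ edge T x (f i), subtree T (f i) x (f j) & lands_down i j x].
Proof.
move=> ji; have := @split_first_step (child T) (child T') (rev p) i j.
rewrite rev_sorted rev_uniq filter_rev -/q; case=> //.
- by move=> x y; rewrite adj_sym; apply: edge_adj.
- by rewrite -[_ (rev p)]infix_rev revK -[infix _ (rev q)]infix_rev revK.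
move=> x [xi xj]; rewrite -[_ (rev p)]infix_rev revK.
by rewrite -[infix _ (rev q)]infix_rev revK => ij; exists x.
Qed.

Lemma split_up_inj i j k x :
  lands_up i j x -> lands_up i k x -> j = k.
Proof.
rewrite /lands_up; case: ifP => _ [] ij ik; apply: split_inj;
  last by rewrite ij ik.
exact: infix2_inj ij ik.
Qed.

Lemma split_down_inj i j k x :
  lands_down i j x -> lands_down i k x -> j = k.
Proof.
rewrite /lands_down; case: ifP => _ [] ij ik; apply: split_inj;
  last by rewrite ij ik.
have infr u v : infix [:: u; v] q = infix [:: v; u] (rev q).
  by rewrite -infix_rev.
by move: ij ik; rewrite !infr; apply: infix2_inj; rewrite rev_uniq.
Qed.

Lemma split_tree : is_directed_tree T'.
Proof.
have incr := split_edge_increasing (height_edge treeT).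
have irr : irreflexive (edge T').
  by move=> i; apply/negP=> /incr; rewrite ltnn.
split=> //; first by move=> i j /incr ij; apply/negP=> /incr; lia.
  exact: split_connected.
apply/acyclicP => // i j k ij ik jk.
have ji : j != i by rewrite eq_sym; apply: contraTneq ij => <-; rewrite adj_irr.
have uniq_step x y : adj T (f i) x -> adj T (f i) y ->
    subtree T (f i) x (f j) -> subtree T (f i) y (f k) -> x = y.
  move=> ix iy xj yk; apply: (tree_acyclic treeT ix iy).
  by apply: subtree_trans (split_subtree xj ji jk) _; rewrite subtree_sym.
case/orP: ij => [/split_first_up|/split_first_down] [x [ix xj jx]];
case/orP: ik => [/split_first_up|/split_first_down] [y [iy yk ky]];
  have xy : x = y by apply: uniq_step => //; rewrite /adj ?ix ?iy ?orbT.
- by rewrite -xy in ky; apply: split_up_inj jx ky.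
- by rewrite xy in ix; have := edge_anti treeT ix iy.
- by rewrite xy in ix; have := edge_anti treeT ix iy.
- by rewrite -xy in ky; apply: split_down_inj jx ky.
Qed.

(** By [step], sending the neighbors [j] of [i] to the first vertex [x] of the
    segment from [f i] to [f j] is injective and compatible with subtrees. *)
Lemma split_slots (P : pred 'I_n) (r : rel 'I_n) (r' : rel 'I_m)
    (R : 'I_m -> 'I_m -> 'I_n -> Prop) i :
    direction T P r -> subrel r' (adj T') ->
    (forall j, r' i j ->
       exists x, [/\ r (f i) x, subtree T (f i) x (f j) & R i j x]) ->
    (forall j k x, R i j x -> R i k x -> j = k) ->
  slots_ok T' r' (P (f i)) i.
Proof.
move=> dirT r'_adj step R_inj.
have inj j k : r' i j -> r' i k ->
    (P (f i) -> (j < i)%N = (k < i)%N) -> j = k.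
  move=> /step[x [ix xj jx]] /step[y [iy yk ky]] jk.
  apply: R_inj jx _; suff -> : x = y by [].
  apply: (slot_inj dirT ix iy) => Pi; have := jk Pi.
  by rewrite -!f_mono (slot_side dirT Pi ix xj) (slot_side dirT Pi iy yk).
rewrite /slots_ok; case Pi: (P (f i)); last first.
  by move=> j k ij ik; apply: inj => //; rewrite Pi.
split=> [j k ij jk|j k ij ik jk]; last exact: inj.
have [x [ix xj _]] := step j ij.
have ji : j != i by rewrite eq_sym (adj_neq split_tree) ?r'_adj.
have xk := split_subtree xj ji jk.
by rewrite -!f_mono (slot_side dirT Pi ix xj) (slot_side dirT Pi ix xk).
Qed.

Lemma split_permutree_gt0 : is_permutree T'.
Proof.
split; first exact: split_tree.
  move=> i; apply: (split_slots (R := lands_up) (direction_up permT)).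
  - exact: edge_adj.
  - exact: split_first_up.
  - by move=> j k x /split_up_inj; apply.
move=> i; apply: (split_slots (R := lands_down) (direction_down permT)).
- by move=> j k jk; rewrite adj_sym; apply: edge_adj.
- exact: split_first_down.
- by move=> j k x /split_down_inj; apply.
Qed.

End Split.

Lemma split_permutree n (T : decograph n) (g m : nat) (f : 'I_m -> 'I_n) side :
    is_permutree T -> (forall i j, (f i < f j)%N = (i < j)%N) ->
    (forall x, (x \in codom f) = ((x < g)%N == side)) ->
  is_permutree (split_side T f g).
Proof.
move=> permT f_mono f_side; case: (posnP m) => [m0|m_gt0].
  subst m; split; [split|..]; try by case.
  by case=> // -[].
apply: (split_permutree_gt0 permT f_mono f_side).
exact: leq_ltn_trans (ltn_ord (f (Ordinal m_gt0))).
Qed.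

Lemma left_label_mono n (g : 'I_n.+1) (i j : 'I_g) :
  (left_label i < left_label j)%N = (i < j)%N.
Proof. by []. Qed.

Lemma left_label_side n (g : 'I_n.+1) x :
  (x \in codom (@left_label n g)) = ((x < g)%N == true).
Proof.
rewrite eqb_id; apply/codomP/idP => [[i ->]|xg]; first exact: (ltn_ord i).
by exists (Ordinal xg); apply: val_inj.
Qed.

Lemma right_label_mono n (g : 'I_n.+1) (i j : 'I_(n - g)) :
  (right_label i < right_label j)%N = (i < j)%N.
Proof. by rewrite /= ltn_add2l. Qed.

Lemma right_label_side n (g : 'I_n.+1) x :
  (x \in codom (@right_label n g)) = ((x < g)%N == false).
Proof.
rewrite eqbF_neg -leqNgt; apply/codomP/idP => [[i ->]|gx] /=.
  exact: leq_addr.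
have xg : (x - g < n - g)%N by rewrite ltn_sub2r // (leq_ltn_trans gx).
by exists (Ordinal xg); apply: val_inj; rewrite /= subnKC.
Qed.

(** * Restricting linear extensions *)

Section Restriction.
Variables (n m g : nat) (f : 'I_m -> 'I_n) (side : bool).
Hypothesis f_mono : forall i j, (f i < f j)%N = (i < j)%N.
Hypothesis f_side : forall x, (x \in codom f) = ((x < g)%N == side).
Variable s : dperm n.

(** [t] is the standardization of the subword of [s] on the chosen side, stated
    without standardizing by sending the values of [t] back along [f]. *)
Definition restricts (t : dperm m) :=
  [seq (f (t.1 p) : nat, t.2 p) | p <- enum 'I_m]
    = [seq l <- word s | (l.1 < g)%N == side].

Lemma restricts_exists : exists t, restricts t.
Proof.
have f_inj := ord_mono_inj f_mono.
pose ps := [seq p <- enum 'I_n | s.1 p \in codom f].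
have ps_uniq : uniq ps by rewrite filter_uniq // enum_uniq.
have sz : size ps == m.
  rewrite -(size_map s.1) -[X in _ == X]card_ord -(card_codom f_inj) eq_sym.
  have u : uniq (map s.1 ps) by rewrite map_inj_uniq //; apply: perm_inj.
  rewrite -(card_uniqP u); apply/eqP/eq_card => x.
  apply/idP/mapP => [xf|[p + ->]]; last by rewrite mem_filter => /andP[].
  exists ((s.1^-1)%g x); last by rewrite permKV.
  by rewrite mem_filter permKV xf mem_enum.
pose phi := tnth (Tuple sz).
have phi_codom p : s.1 (phi p) \in codom f.
  by have := mem_tnth p (Tuple sz); rewrite mem_filter => /andP[].
pose tau p := iinv (phi_codom p).
have tauE p : f (tau p) = s.1 (phi p) by apply: f_iinv.
have tau_inj : injective tau.
  move=> p p' /(congr1 f); rewrite !tauE => /perm_inj; exact/tuple_uniqP.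
exists (perm tau_inj, [ffun p => s.2 (phi p)]); rewrite /restricts /word.
rewrite filter_map; transitivity [seq (s.1 p : nat, s.2 p) | p <- ps].
  rewrite -[ps]/(tval (Tuple sz)) -[in RHS](map_tnth_enum (Tuple sz)) -map_comp.
  by apply: eq_map => p /=; rewrite permE ffunE tauE.
by congr map; apply: eq_filter => p; rewrite f_side.
Qed.

Lemma restricts_linear_extension (T : decograph n) (t : dperm m) :
    is_permutree T -> linear_extension T s -> restricts t ->
  linear_extension (split_side T f g) t.
Proof.
move=> permT /andP[/'forall_forallP ord_s /forallP deco_s] tE.
apply/andP; split; last first.
  apply/forallP=> p; have : (f (t.1 p) : nat, t.2 p) \in word s.
    have := mem_filter (fun l : nat * decoration => (l.1 < g)%N == side).
    move=> /(_ (f (t.1 p) : nat, t.2 p) (word s)); rewrite -tE.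
    by rewrite map_f ?mem_enum // => /esym/andP[].
  by case/mapP=> p' _ [/val_inj tp ->]; rewrite /= tp; apply: deco_s.
apply/'forall_forallP=> i j; apply/implyP=> ij.
have n_gt0 : (0 < n)%N by apply: leq_ltn_trans (ltn_ord (f i)).
pose h x : nat := (s.1^-1)%g x.
have h_edge x y : edge T x y -> (h x < h y)%N by apply/implyP/ord_s.
have := split_edge_increasing permT n_gt0 h_edge ij.
apply: contraTT; rewrite -!leqNgt leq_eqVlt => /orP[/eqP|].
  by move/val_inj/perm_inj->.
have h_tr : transitive (relpre h ltn) by move=> x y z; apply: ltn_trans.
have h_sorted : sorted (relpre h ltn) [seq f (t.1 p) | p <- enum 'I_m].
  have -> : [seq f (t.1 p) | p <- enum 'I_m]
          = [seq x : 'I_n <- [seq s.1 p | p <- enum 'I_n] | (x < g)%N == side].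
    apply: (inj_map val_inj); rewrite -map_comp.
    have /(congr1 (map fst)) := tE.
    rewrite -map_comp /word !filter_map -!map_comp.
    by move=> ->; congr map.
  apply: (sorted_filter h_tr); rewrite sorted_map.
  have := iota_ltn_sorted 0 n; rewrite -val_enum_ord sorted_map.
  by apply: sub_sorted => p p'; rewrite /h /= !permK.
have in_dom (k : 'I_m) :
    (k : nat) \in [pred l | (l < size [seq f (t.1 p) | p <- enum 'I_m])%N].
  by rewrite inE size_map size_enum_ord.
move=> ji.
have := sorted_ltn_nth h_tr (f i) h_sorted _ _ (in_dom _) (in_dom _) ji.
have nthE (k : 'I_m) :
    nth (f i) [seq f (t.1 p) | p <- enum 'I_m] k = f (t.1 k).
  by rewrite (nth_map k) ?size_enum_ord // nth_ord_enum.
by rewrite !nthE !permKV; apply: ltnW.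
Qed.

End Restriction.

Lemma word_inj n : injective (@word n).
Proof.
move=> [s d] [s' d'] /eq_in_map E.
have sE p : s p = s' p by apply: val_inj; have [] := E p (mem_enum _ p).
have dE p : d p = d' p by have [] := E p (mem_enum _ p).
by congr pair; [apply/permP|apply/ffunP].
Qed.

Lemma shift_word_inj k : injective (shift_word k).
Proof. by apply: inj_map => -[a d] [b d'] /= [/addnI-> ->]. Qed.

(** * Coproducts *)

(** The mask of the shuffle has to be the one computed by [P]. *)
Lemma is_shuffleE (A : eqType) (P : pred A) (w w1 w2 : seq A) :
    all P w1 -> all (predC P) w2 ->
  is_shuffle w w1 w2 = (w1 == filter P w) && (w2 == filter (predC P) w).
Proof.
move=> P1 P2; apply/existsP/andP; last first.
  move=> [/eqP-> /eqP->].
  have szP : size (map P w) == size w by rewrite size_map.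
  by exists (Tuple szP); rewrite /= !filter_mask -map_comp !eqxx.
move=> [[m szm] /= /andP[/eqP m1 /eqP m2]].
have mE : m = map P w.
  move: P1 P2; rewrite -m1 -m2; move/eqP: szm.
  elim: m w {m1 m2} => [[]|[] b IHb [|x w]] //= [sb].
    by case/andP=> -> P1 P2; congr cons; apply: IHb.
  by move=> P1 /andP[/negbTE-> P2]; congr cons; apply: IHb.
by rewrite -m1 -m2 mE !filter_mask -map_comp !eqxx.
Qed.

Local Open Scope ring_scope.
Import GRing.Theory.

Section TensorLinear.
Variables (K : fieldType) (V W V' W' : lmodType K).
Variables (f : {linear V -> V'}) (h : {linear W -> W'}).

Lemma tensor_map_is_linear : linear (tensor_map f h).
Proof.
pose F := linext (fun p : V * W => tens (f p.1) (h p.2)).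
have F_rel x : tensor_rel x -> F x = 0.
  case=> [v v' w|v w w'|a v w|a v w]; rewrite /F.
  - by rewrite !linearB /= !linextU /= linearD tensDl -addrA -opprD subrr.
  - by rewrite !linearB /= !linextU /= linearD tensDr -addrA -opprD subrr.
  - by rewrite linearB linearZ /= !linextU /= linearZ tensZl subrr.
  - by rewrite linearB linearZ /= !linextU /= linearZ tensZr subrr.
move=> a x y; rewrite -[x]qpi_repr -[y]qpi_repr -qpiZ -qpiD.
by rewrite /tensor_map !(qliftE F_rel) linearP.
Qed.

HB.instance Definition _ := GRing.isLinear.Build K (tensor V W) (tensor V' W')
  _ (tensor_map f h) tensor_map_is_linear.

End TensorLinear.

Section Coproduct.
Variable K : fieldType.

HB.instance Definition _ :=
  GRing.Linear.copy (@PTd_pi K) (qpi (@permutree_rel K)).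
HB.instance Definition _ :=
  GRing.Linear.copy (@coprodFQ K) (linext (@coprodG K)).

Lemma Qbasis_linear_extension n (T : decograph n) (s : dperm n) :
  is_permutree T -> linear_extension T s -> Qbasis K T = PTd_pi (Gbasis K s).
Proof.
move=> permT ext; rewrite /Qbasis; case: pickP => [s' ext'|/(_ s)]; last first.
  by rewrite ext.
by apply/qpiP/span_gen; exact: (@PermutreeRel K n (Permutree permT)).
Qed.

(** The values of the first factor are below [k] and the shifted values of the
    second one are not, so [k] determines both factors. *)
Lemma coprodG_restricts n (s : dperm n)
    (tl : forall k : 'I_n.+1, dperm k)
    (tr : forall k : 'I_n.+1, dperm (n - k)) :
    (forall k : 'I_n.+1, restricts k (@left_label n k) true s (tl k)) ->
    (forall k : 'I_n.+1, restricts k (@right_label n k) false s (tr k)) ->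
  coprodG K (Tagged _ s)
    = \sum_(k < n.+1) tens (Gbasis K (tl k)) (Gbasis K (tr k)).
Proof.
move=> tlE trE; rewrite /coprodG /=; apply: eq_bigr => k _.
apply: (big_pred1 (tl k, tr k)) => -[t u].
rewrite (is_shuffleE (P := fun l => (l.1 < k)%N)).
- have -> : [seq l <- word s | (l.1 < k)%N] = word (tl k).
    by apply: etrans (esym (tlE k)); apply: eq_filter => l; rewrite eqb_id.
  have -> : filter (predC (fun l : nat * decoration => (l.1 < k)%N)) (word s)
          = shift_word k (word (tr k)).
    rewrite /shift_word -map_comp; apply: etrans (esym (trE k)).
    by apply: eq_filter => l; rewrite eqbF_neg.
  rewrite (inj_eq (@shift_word_inj _)).
  by rewrite (inj_eq (@word_inj k)) (inj_eq (@word_inj (n - k))).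
- by apply/allP=> _ /mapP[p _ ->] /=; apply: ltn_ord.
- by apply/allP=> _ /mapP[l _ ->] /=; rewrite -leqNgt leq_addr.
Qed.

(** The right-hand side no longer depends on [s]: this is at once the fact that
    the coproduct descends to the quotient and the formula for it. *)
Lemma coprod_linear_extension n (T : decograph n) (s : dperm n) :
    is_permutree T -> linear_extension T s ->
  tensor_map (PTd_pi (K := K)) (PTd_pi (K := K)) (coprodFQ (Gbasis K s))
    = \sum_(g < n.+1)
        tens (Qbasis K (left_split T g)) (Qbasis K (right_split T g)).
Proof.
move=> permT ext.
have /fin_all_exists[tl tlE] (k : 'I_n.+1) :=
  restricts_exists (@left_label_mono n k) (@left_label_side n k) s.
have /fin_all_exists[tr trE] (k : 'I_n.+1) :=
  restricts_exists (@right_label_mono n k) (@right_label_side n k) s.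
rewrite /coprodFQ linextU (coprodG_restricts tlE trE) linear_sum.
apply: eq_bigr => k _; rewrite /= tensor_mapE.
have permL :=
  split_permutree permT (@left_label_mono n k) (@left_label_side n k).
have permR :=
  split_permutree permT (@right_label_mono n k) (@right_label_side n k).
have extL := restricts_linear_extension permT ext (tlE k).
have extR := restricts_linear_extension permT ext (trE k).
rewrite (Qbasis_linear_extension permL extL).
by rewrite (Qbasis_linear_extension permR extR).
Qed.

End Coproduct.

Theorem proposition67 (K : fieldType) (n : nat) (S : permutree n) :
  (forall g : 'I_n.+1,
     is_permutree (left_split S g) /\ is_permutree (right_split S g)) /\
  coprodPT (Qbasis K S) =
    \sum_(g < n.+1)
      tens (Qbasis K (left_split S g)) (Qbasis K (right_split S g)).
Proof.
have permS := permutreeP S; split=> [g|].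
  split.
    apply: (split_permutree permS); first exact: left_label_mono.
    exact: left_label_side.
  apply: (split_permutree permS); first exact: right_label_mono.
  exact: right_label_side.
have [s ext] := linear_extension_exists (permutree_tree permS).
rewrite (Qbasis_linear_extension K permS ext).
rewrite -(coprod_linear_extension K permS ext).
pose F : {linear FQSymd K -> tensor (PTd K) (PTd K)} :=
  tensor_map (@PTd_pi K) (@PTd_pi K) \o @coprodFQ K.
apply: (qliftE (f := F)) => _ [m T t t' ext_t ext_t'].
have F_ext u (ext_u : linear_extension T u) :=
  coprod_linear_extension K (permutreeP T) ext_u : F (Gbasis K u) = _.
apply: etrans (linearB F _ _) _; apply/eqP; rewrite subr_eq0; apply/eqP.
exact: etrans (F_ext t ext_t) (esym (F_ext t' ext_t')).
Qed.
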